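(* Let $p\in(0,1)$, let $C$ be a random symmetric $n\times n$ matrix whose entries on and above the diagonal are independent and equal to $\sqrt{(1-p)/p}$ with probability $p$ and $-\sqrt{p/(1-p)}$ with probability $1-p$. Let $M\in\mathbb{R}^{n\times n}$ be a deterministic matrix, $r_p=\sqrt{(1-p)/p}$, $E=r_p\,M\circ C$, and let $m_E$ be a median of $\|E\|_2$. Then for all $t>0$, $$P\big(|\|E\|_2-m_E|>t\big)\le4\exp\Big(-\frac{p^2}{8\|M\|_\infty^2}t^2\Big).$$ In particular, $$\mathbb{E}\big[\|E\|_2^2\big]\le m_E^2+32\frac{\|M\|_\infty^2}{p^2}+8m_E\sqrt{\frac{2\pi\|M\|_\infty^2}{p^2}}$$ and $$\mathbb{E}\big[\|E\|_2^3\big]\le4m_E^3+12\sqrt{\pi}\Big(\frac{8\|M\|_\infty^2}{p^2}\Big)^{3/2}.$$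
   Context: $\circ$ is the Hadamard product; $\|M\|_\infty=\max_{ij}|M_{ij}|$; $\|\cdot\|_2$ is the spectral norm. *)

(* Defs.v *)
From HB Require Import structures.
From mathcomp Require Import all_boot all_order all_algebra.
From mathcomp Require Import all_classical all_reals all_analysis.
Set Implicit Arguments. Unset Strict Implicit. Unset Printing Implicit Defensive.
Import Order.TTheory GRing.Theory Num.Theory.
Local Open Scope ring_scope.
Local Open Scope classical_set_scope.

Definition UIdx (n : nat) : finType := {x : 'I_n * 'I_n | (x.1 <= x.2)%N}.

Definition Omega (n : nat) : finType := {ffun UIdx n -> bool}.

Section Defs.
Variable R : realType.

Definition weight (n : nat) (p : R) (b : Omega n) : R :=
  \prod_(k : UIdx n) (if b k then p else 1 - p).

Definition Prob (n : nat) (p : R) (A : pred (Omega n)) : R :=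
  \sum_(b : Omega n | A b) weight p b.

Definition Expect (n : nat) (p : R) (f : Omega n -> R) : R :=
  \sum_(b : Omega n) weight p b * f b.

(* The outcome attached to the unordered pair {i,j}: read at (min i j, max i j)
   (the [insub] always succeeds since min <= max). *)
Definition outcome (n : nat) (b : Omega n) (i j : 'I_n) : bool :=
  let k := if (i <= j)%N then (i, j) else (j, i) in
  match (insub k : option (UIdx n)) with Some u => b u | None => false end.

Definition Cmat (n : nat) (p : R) (b : Omega n) : 'M[R]_n :=
  \matrix_(i, j) (if outcome b i j then Num.sqrt ((1 - p) / p)
                  else - Num.sqrt (p / (1 - p))).

Definition rp (p : R) : R := Num.sqrt ((1 - p) / p).

Definition Emat (n : nat) (p : R) (M : 'M[R]_n) (b : Omega n) : 'M[R]_n :=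
  \matrix_(i, j) (rp p * (M i j * Cmat p b i j)).

Definition vnorm2 (n : nat) (x : 'cV[R]_n) : R := Num.sqrt (\sum_i x i 0 ^+ 2).

Definition specnorm (n : nat) (A : 'M[R]_n) : R :=
  sup [set vnorm2 (A *m x) | x in [set x : 'cV[R]_n | vnorm2 x <= 1]].

Definition maxnorm (n : nat) (A : 'M[R]_n) : R :=
  \big[Num.max/0]_(i < n) \big[Num.max/0]_(j < n) `|A i j|.

Definition is_median (n : nat) (p : R) (X : Omega n -> R) (m : R) : Prop :=
  Prob p (fun b => X b <= m) >= 1/2 /\ Prob p (fun b => X b >= m) >= 1/2.

End Defs.

(* Main.v *)
Require Import Defs.
From HB Require Import structures.
From mathcomp Require Import all_boot all_order all_algebra.
From mathcomp Require Import all_classical all_reals all_analysis.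
From mathcomp Require Import measurable_realfun ring lra.
Set Implicit Arguments.
Unset Strict Implicit.
Unset Printing Implicit Defensive.
Import Order.TTheory GRing.Theory Num.Theory.
Import numFieldNormedType.Exports.
Local Open Scope ring_scope.

(** Since [r_p C] takes the values [1/p - 1] and [-1], the matrix [E] is an affine
    function of a vector of independent Bernoulli variables, and [F = ||E||_2] extends to a
    convex function on the cube [0,1]^N, with Lipschitz constant [L = sqrt 2 * K] where
    [K = ||M||_oo / p] (each variable enters at most two entries).  Maurey's form of
    Talagrand's inequality says that [E e^(Q f) * E e^(-f) <= 1] for every convex [f],
    where [Q f x = inf_y (f y + |x - y|^2 / 4)]; it is proved by induction on [N].
    For [f = c F] one has [Q f >= c F - c^2 L^2], hence
    [E e^(c F) * E e^(-c F) <= e^(c^2 L^2)].  By Markov's inequality with the optimal [c],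
    [P(F >= a + t) * P(F <= a) <= e^(- t^2 / (4 L^2))]; taking [a = m] and [a = m - t]
    gives both tails.  The moment bounds follow by integrating the tail of [Y = |F - m|],
    from [F^2 <= m^2 + 2 m Y + Y^2] and [F^3 <= 4 (m^3 + Y^3)]. *)

(** * An exponential inequality *)

Section ExpInequality.
Variable R : realType.

(** Equality holds at 0, and the left side is nonincreasing on [0, 1/2]: [1 - 2x <= e^(-2x)] bounds
    the derivative of the first term by [e^(-x - x^2) <= e^(-x)]. The auxiliary [f] is the negated
    sum, so that it is nondecreasing. *)
Lemma expRDN_le2 (d : R) : 0 <= d <= 1/2 -> expR (d - d ^+ 2) + expR (- d) <= 2.
Proof.
move=> /andP[d0 d1].
pose f (x : R) : R := - (expR (x - x ^+ 2) + expR (- x)).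
have der (x : R) : is_derive x 1 f (- ((1 - 2 * x) * expR (x - x ^+ 2) - expR (- x))).
  by apply: is_derive_eq; rewrite /GRing.scale /=; ring.
have : f 0 <= f d.
  apply: (@ger0_derive1_ndecr R f 0 (1/2)) => //.
  - move=> x; rewrite in_itv /= => /andP[x0 x1].
    rewrite derive1E derive_val oppr_ge0 subr_le0.
    have -> : x - x ^+ 2 = 2 * x + (- x ^+ 2 - x) by ring.
    rewrite expRD mulrA.
    have h : (1 - 2 * x) * expR (2 * x) <= 1.
      have := expR_ge1Dx (- (2 * x)) => h.
      rewrite -[leRHS](expRxMexpNx_1 (- (2 * x))) opprK ler_pM2r ?expR_gt0//.
    apply: le_trans (_ : 1 * expR (- x ^+ 2 - x) <= _).
      by rewrite ler_pM2r ?expR_gt0.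
    by rewrite mul1r ler_expR; nra.
  - by apply: derivable_within_continuous => x _; exact: ex_derive.
rewrite /f !(expr0n, oppr0, subr0, expR0) /=; lra.
Qed.

(** This is the case [d = 1/2] of the previous bound. It settles every larger [d] in the next lemma,
    because at [l = 1] the exponent there is 1/4 whatever [d] is, while [2 - e^(-d)] increases with
    [d]. *)
Lemma expR_half_quarter : expR (1/4 : R) + expR (- (1/2)) <= 2.
Proof.
apply: le_trans (@expRDN_le2 (1/2) _); last lra.
by rewrite lerD2r ler_expR; lra.
Qed.

(* The optimal [l] is [min (2 * d) 1]. *)
Lemma expR_interpolation (d : R) : 0 <= d ->
  exists2 l, 0 <= l <= 1 & expR ((1 - l) * d + l ^+ 2 / 4) <= 2 - expR (- d).
Proof.
move=> d0; have [d1|d1] := leP d (1/2).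
  exists (2 * d); first lra.
  have := @expRDN_le2 d; rewrite d0 d1 => /(_ isT) h.
  have -> : (1 - 2 * d) * d + (2 * d) ^+ 2 / 4 = d - d ^+ 2 by field.
  lra.
exists 1; first lra.
have h : expR (- d) <= expR (- (1/2)) by rewrite ler_expR; lra.
have := expR_half_quarter.
have -> : (1 - 1) * d + 1 ^+ 2 / 4 = 1/4 by field.
lra.
Qed.

(** The tangent at the weighted mean [w] lies below the graph; averaging its values at [u] and [v]
    returns [expR w]. *)
Lemma expR_convex (l u v : R) : 0 <= l <= 1 ->
  expR ((1 - l) * u + l * v) <= (1 - l) * expR u + l * expR v.
Proof.
move=> /andP[l0 l1].
set w := (1 - l) * u + l * v.
have tangent z : expR w * (1 + (z - w)) <= expR z.
  have -> : expR z = expR w * expR (z - w) by rewrite -expRD; congr expR; ring.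
  by rewrite ler_pM2l ?expR_gt0 ?expR_ge1Dx.
have -> : expR w = (1 - l) * (expR w * (1 + (u - w))) + l * (expR w * (1 + (v - w))).
  transitivity (expR w * (1 + ((1 - l) * u + l * v - w))); last by ring.
  by rewrite -/w subrr addr0 mulr1.
by rewrite lerD// ler_wpM2l// subr_ge0.
Qed.

End ExpInequality.

(** * Maurey's inequality on the cube *)

Section InfimumConvolution.
Variable R : realType.
Implicit Types (f g : (nat -> R) -> R) (x y z : nat -> R).

(* Points of the cube [0,1]^N are functions on [nat] of which only the first [N] values matter. *)
Definition scons (a : R) x : nat -> R := fun i => if i is j.+1 then x j else a.

Definition in_cube x := forall i, 0 <= x i <= 1.

Definition cube_convex f := forall l y z, 0 <= l <= 1 -> in_cube y -> in_cube z ->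
  f (fun i => (1 - l) * y i + l * z i) <= (1 - l) * f y + l * f z.

Definition sqdist N x y : R := \sum_(i < N) (x i - y i) ^+ 2.

(** The infimum runs over the solid cube, not only its vertices, so that convex combinations of
    competitors are again competitors. *)
Definition infconv N f x : R :=
  inf [set f y + sqdist N x y / 4 | y in in_cube]%classic.

(** Expectation of [g] at [N] independent Bernoulli(p) coordinates, all later coordinates being 0.
    Conditioning on the first coordinate prepares the induction on [N]. *)
Fixpoint cubeE (p : R) N g : R :=
  if N is N'.+1 then
    (1 - p) * cubeE p N' (fun y => g (scons 0 y)) + p * cubeE p N' (fun y => g (scons 1 y))
  else g (fun=> 0).

Lemma in_cube_scons a x : 0 <= a <= 1 -> in_cube x -> in_cube (scons a x).
Proof. by move=> ha hx []. Qed.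

Lemma scons_combine l a b y z :
  (fun i => (1 - l) * scons a y i + l * scons b z i) =
  scons ((1 - l) * a + l * b) (fun i => (1 - l) * y i + l * z i).
Proof. by apply/funext => -[]. Qed.

Lemma cube_convex_scons a f : 0 <= a <= 1 -> cube_convex f ->
  cube_convex (fun y => f (scons a y)).
Proof.
move=> ha hf l y z hl hy hz.
have := hf l (scons a y) (scons a z) hl (in_cube_scons ha hy) (in_cube_scons ha hz).
rewrite scons_combine; congr (f (scons _ _) <= _); ring.
Qed.

Lemma cubeE_le p N g h : 0 <= p <= 1 -> (forall y, g y <= h y) ->
  cubeE p N g <= cubeE p N h.
Proof.
move=> /andP[p0 p1]; elim: N g h => [|N IH] g h gh //=.
by rewrite lerD// ler_wpM2l ?subr_ge0// IH.
Qed.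

Lemma cubeE_gt0 p N g : 0 <= p <= 1 -> (forall y, 0 < g y) -> 0 < cubeE p N g.
Proof.
move=> p01; elim: N g => [|N IH] g g0 //=.
have h0 := IH (fun y => g (scons 0 y)) (fun y => g0 _).
have h1 := IH (fun y => g (scons 1 y)) (fun y => g0 _).
nra.
Qed.

Lemma cubeE_lin p N a b g h :
  cubeE p N (fun y => a * g y + b * h y) = a * cubeE p N g + b * cubeE p N h.
Proof. by elim: N g h => [|N IH] g h //=; rewrite !IH; ring. Qed.

Lemma sqdist_ge0 N x y : 0 <= sqdist N x y.
Proof. by apply: sumr_ge0 => i _; exact: sqr_ge0. Qed.

Lemma infconv_has_inf N f x : (forall y, in_cube y -> 0 <= f y) ->
  has_inf [set f y + sqdist N x y / 4 | y in in_cube]%classic.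
Proof.
move=> f0; split.
  by exists (f (fun=> 0) + sqdist N x (fun=> 0) / 4), (fun=> 0) => // i; rewrite lexx ler01.
exists 0 => _ [y hy <-]; apply: addr_ge0; first exact: f0.
by apply: divr_ge0 => //; exact: sqdist_ge0.
Qed.

Lemma infconv_le N f x y : (forall y, in_cube y -> 0 <= f y) -> in_cube y ->
  infconv N f x <= f y + sqdist N x y / 4.
Proof.
move=> f0 hy; apply: ge_inf; last by exists y.
exact: (infconv_has_inf N x f0).2.
Qed.

(** The infima need not be attained, so elements within [e] of them are compared; since the weights
    add up to 1, the total loss is exactly [e]. *)
Lemma le_inf_combine (S T : set R) (l c : R) : 0 <= l <= 1 ->
  has_inf S -> has_inf T ->
  (forall s t, S s -> T t -> c <= (1 - l) * s + l * t) ->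
  c <= (1 - l) * inf S + l * inf T.
Proof.
move=> /andP[l0 l1] hS hT h; apply/ler_addgt0Pr => e e0.
have [s Ss hs] := inf_adherent e0 hS.
have [t Tt ht] := inf_adherent e0 hT.
apply: le_trans (h s t Ss Tt) _.
have : (1 - l) * s + l * t <= (1 - l) * (inf S + e) + l * (inf T + e).
  by rewrite lerD// ler_wpM2l ?subr_ge0// ltW.
by move/le_trans; apply; rewrite le_eqVlt; apply/orP; left; apply/eqP; ring.
Qed.

Lemma sqdist_convex N x y z l : 0 <= l <= 1 ->
  sqdist N x (fun i => (1 - l) * y i + l * z i) <=
  (1 - l) * sqdist N x y + l * sqdist N x z.
Proof.
move=> /andP[l0 l1]; rewrite /sqdist !mulr_sumr -big_split /=.
apply: ler_sum => i _; rewrite -subr_ge0.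
have -> : (1 - l) * (x i - y i) ^+ 2 + l * (x i - z i) ^+ 2 -
  (x i - ((1 - l) * y i + l * z i)) ^+ 2 = l * (1 - l) * (y i - z i) ^+ 2 by ring.
by apply: mulr_ge0; rewrite ?sqr_ge0//; apply: mulr_ge0; rewrite ?subr_ge0.
Qed.

Lemma sqdist_scons N x y a b :
  sqdist N.+1 (scons a x) (scons b y) = (a - b) ^+ 2 + sqdist N x y.
Proof. by rewrite /sqdist big_ord_recl. Qed.

(** Given competitors [y] and [z] for the two sections, the combination of [scons a y] and
    [scons b z] is a competitor for [scons a x]. Its first coordinate differs from [a] by
    [l * (a - b)], of square at most [l^2], which is the source of [l^2 / 4]. *)
Lemma infconv_scons N f x a b l : 0 <= a <= 1 -> 0 <= b <= 1 -> 0 <= l <= 1 ->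
  cube_convex f -> (forall y, in_cube y -> 0 <= f y) ->
  infconv N.+1 f (scons a x) <=
  (1 - l) * infconv N (fun y => f (scons a y)) x +
  l * infconv N (fun y => f (scons b y)) x + l ^+ 2 / 4.
Proof.
move=> ha hb hl fconv f0; rewrite -lerBlDr; apply: le_inf_combine => //.
- by apply: infconv_has_inf => y hy; apply/f0/in_cube_scons.
- by apply: infconv_has_inf => y hy; apply/f0/in_cube_scons.
move=> _ _ [y hy <-] [z hz <-]; rewrite lerBlDr.
have Cy := in_cube_scons ha hy; have Cz := in_cube_scons hb hz.
have hw : in_cube (fun i => (1 - l) * scons a y i + l * scons b z i).
  by move=> i; have := Cy i; have := Cz i; nra.
apply: le_trans (infconv_le N.+1 (scons a x) f0 hw) _.
have h1 := fconv _ _ _ hl Cy Cz.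
have h2 := sqdist_convex N x y z hl.
have h3 : (a - ((1 - l) * a + l * b)) ^+ 2 <= l ^+ 2.
  have -> : a - ((1 - l) * a + l * b) = l * (a - b) by ring.
  rewrite exprMn ler_piMr ?sqr_ge0//; nra.
move: h1; rewrite scons_combine sqdist_scons => h1; lra.
Qed.

(** Hölder's inequality with weights [1 - l] and [l]: after shifting [u] by [al] and [v] by [be],
    both exponentials have mean at most 1, and convexity of [expR] applies pointwise. *)
Lemma cubeE_expR_combine p N g u v l c al be : 0 <= p <= 1 -> 0 <= l <= 1 ->
  (forall y, g y <= (1 - l) * u y + l * v y + c) ->
  cubeE p N (fun y => expR (u y)) <= expR al ->
  cubeE p N (fun y => expR (v y)) <= expR be ->
  cubeE p N (fun y => expR (g y)) <= expR ((1 - l) * al + l * be + c).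
Proof.
move=> p01 l01 hg hu hv; set k := (1 - l) * al + l * be + c.
apply: le_trans (_ : cubeE p N (fun y => (expR k * (1 - l) * expR (- al)) * expR (u y) +
    (expR k * l * expR (- be)) * expR (v y)) <= _).
  apply: cubeE_le => // y.
  have -> : expR k * (1 - l) * expR (- al) * expR (u y) + expR k * l * expR (- be) * expR (v y)
     = expR k * ((1 - l) * expR (u y - al) + l * expR (v y - be)).
    by rewrite !expRD; ring.
  apply: le_trans (_ : expR k * expR ((1 - l) * (u y - al) + l * (v y - be)) <= _).
    by rewrite -expRD ler_expR; apply: le_trans (hg y) _; rewrite /k; lra.
  by rewrite ler_pM2l ?expR_gt0// expR_convex.
rewrite cubeE_lin.
have k0 := expR_gt0 k.
have ha : expR (- al) * cubeE p N (fun y => expR (u y)) <= 1.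
  by rewrite mulrC -(expRxMexpNx_1 al) ler_pM2r ?expR_gt0.
have hb : expR (- be) * cubeE p N (fun y => expR (v y)) <= 1.
  by rewrite mulrC -(expRxMexpNx_1 be) ler_pM2r ?expR_gt0.
rewrite -!mulrA -mulrDr ger_pMr//; nra.
Qed.

(** The inductive step in one coordinate. Only the section with the larger exponent is interpolated:
    the [l] chosen for the gap [a1 - a0] gives [B1 <= e^a0 * (2 - r)], and the product is then at
    most [1 - (p * (1 - r))^2]. *)
Lemma two_point (p q B0 B1 a0 a1 : R) : 0 <= p -> 0 <= q -> p + q = 1 -> a0 <= a1 ->
  B0 <= expR a0 ->
  (forall l, 0 <= l <= 1 -> B1 <= expR ((1 - l) * a1 + l * a0 + l ^+ 2 / 4)) ->
  (q * B0 + p * B1) * (q * expR (- a0) + p * expR (- a1)) <= 1.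
Proof.
move=> p0 q0 pq a01 h0 h1.
have d0 : 0 <= a1 - a0 by rewrite subr_ge0.
have [l l01 hl] := expR_interpolation d0.
set r := expR (- (a1 - a0)) in hl.
have r0 : 0 < r by exact: expR_gt0.
have {}h1 : B1 <= expR a0 * (2 - r).
  apply: le_trans (h1 l l01) _.
  have -> : (1 - l) * a1 + l * a0 + l ^+ 2 / 4 = a0 + ((1 - l) * (a1 - a0) + l ^+ 2 / 4) by ring.
  by rewrite expRD ler_pM2l ?expR_gt0.
have e1 : expR (- a1) = expR (- a0) * r by rewrite /r -expRD; congr expR; ring.
have e0 := expRxMexpNx_1 a0.
have w0 := expR_gt0 (- a0).
rewrite e1.
apply: le_trans (_ : (q * expR a0 + p * (expR a0 * (2 - r))) *
                     (q * expR (- a0) + p * (expR (- a0) * r)) <= _).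
  rewrite ler_wpM2r//; first by rewrite addr_ge0 ?mulr_ge0// ltW.
  by rewrite lerD// ler_wpM2l.
have -> : (q * expR a0 + p * (expR a0 * (2 - r))) * (q * expR (- a0) + p * (expR (- a0) * r))
  = (expR a0 * expR (- a0)) * ((q + p * (2 - r)) * (q + p * r)) by ring.
rewrite e0 mul1r.
have -> : q = 1 - p by lra.
have -> : (1 - p + p * (2 - r)) * (1 - p + p * r) = 1 - (p * (1 - r)) ^+ 2 by ring.
by rewrite lerBlDr lerDl sqr_ge0.
Qed.

Theorem cubeE_infconv p N f : 0 <= p <= 1 -> cube_convex f ->
  (forall y, in_cube y -> 0 <= f y) ->
  cubeE p N (fun x => expR (infconv N f x)) * cubeE p N (fun x => expR (- f x)) <= 1.
Proof.
move=> p01; elim: N f => [|N IH] f fconv f0 /=.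
  rewrite -expRD -expR0 ler_expR subr_le0.
  have /= := @infconv_le 0 f (fun=> 0) (fun=> 0) f0.
  by rewrite /sqdist big_ord0 mul0r addr0; apply => i; rewrite lexx ler01.
have z01 : 0 <= (0 : R) <= 1 by rewrite lexx ler01.
have o01 : 0 <= (1 : R) <= 1 by rewrite lexx ler01.
pose fa a y := f (scons a y).
pose U a := cubeE p N (fun x => expR (- fa a x)).
have U0 a : 0 < U a by apply: cubeE_gt0 => // y; exact: expR_gt0.
(* With [U a = e^(- al a)], the induction hypothesis for the section at [a] takes the form [hQ], the
   input of the Hölder step. *)
pose al a := - ln (U a).
have UE a : U a = expR (- al a) by rewrite opprK lnK// posrE.
have hQ a : 0 <= a <= 1 -> cubeE p N (fun x => expR (infconv N (fa a) x)) <= expR (al a).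
  move=> ha.
  have fa0 y : in_cube y -> 0 <= fa a y by move=> hy; apply/f0/in_cube_scons.
  have := IH _ (cube_convex_scons ha fconv) fa0.
  by rewrite -/(U a) UE -(expRxMexpNx_1 (al a)) ler_pM2r ?expR_gt0.
pose B a := cubeE p N (fun x => expR (infconv N.+1 f (scons a x))).
have hB a b l : 0 <= a <= 1 -> 0 <= b <= 1 -> 0 <= l <= 1 ->
    B a <= expR ((1 - l) * al a + l * al b + l ^+ 2 / 4).
  move=> ha hb hl; apply: cubeE_expR_combine (hQ _ ha) (hQ _ hb) => // y.
  exact: infconv_scons.
have hB0 a : 0 <= a <= 1 -> B a <= expR (al a).
  move=> ha; have := hB a a 0 ha ha z01.
  by rewrite subr0 mul1r mul0r addr0 expr0n /= mul0r addr0.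
rewrite -/(B 0) -/(B 1) -/(U 0) -/(U 1) !UE.
have [le|/ltW le] := leP (al 0) (al 1).
  apply: two_point => //; [lra|lra|lra|exact: hB0|].
  by move=> l hl; exact: hB.
(* When [al 1 <= al 0] the two sections exchange roles, and so do [p] and [1 - p]. *)
rewrite addrC [X in _ * X]addrC.
apply: two_point => //; [lra|lra|lra|exact: hB0|].
by move=> l hl; exact: hB.
Qed.

End InfimumConvolution.

(** * Sums over Boolean functions *)

Section BooleanCube.
Variable R : realType.

Definition ffun_cons N (ab : bool * {ffun 'I_N -> bool}) : {ffun 'I_N.+1 -> bool} :=
  [ffun i => if unlift ord0 i is Some j then ab.2 j else ab.1].

Lemma ffun_cons_bij N : bijective (@ffun_cons N).
Proof.
exists (fun b : {ffun 'I_N.+1 -> bool} => (b ord0, [ffun j : 'I_N => b (lift ord0 j)])).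
  move=> [a b] /=; rewrite ffunE unlift_none; congr (_, _).
  by apply/ffunP => j; rewrite !ffunE liftK.
move=> b; apply/ffunP => i; rewrite ffunE.
by case: unliftP => [j ->|->] /=; rewrite ?ffunE.
Qed.

(** The default 0 beyond [N] agrees with the base point of [cubeE]. *)
Definition ffun_point N (b : {ffun 'I_N -> bool}) (i : nat) : R :=
  if insub i is Some k then (b k)%:R else 0.

Lemma ffun_point_cons N a (b : {ffun 'I_N -> bool}) :
  ffun_point (ffun_cons (a, b)) = scons a%:R (ffun_point b).
Proof.
apply/funext => -[|i]; rewrite /ffun_point /=.
  by rewrite insubT /= ffunE (_ : Sub _ _ = ord0) ?unlift_none//; exact/val_inj.
case: (boolP (i < N)%N) => hi; last by rewrite !insubF//; apply/negbTE.
rewrite (insubT (fun m => (m < N)%N) hi) (insubT (fun m => (m < N.+1)%N) (hi : (i.+1 < N.+1)%N)) /= ffunE.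
by rewrite (_ : Sub _ _ = lift ord0 (Sub i hi)) ?liftK//; exact/val_inj.
Qed.

Lemma sum_ffun_cubeE (p : R) N (g : (nat -> R) -> R) :
  \sum_(b : {ffun 'I_N -> bool}) (\prod_k (if b k then p else 1 - p)) * g (ffun_point b) =
  cubeE p N g.
Proof.
elim: N g => [|N IH] g /=.
  rewrite (big_pred1 [ffun=> false]); last first.
    by move=> b; symmetry; apply/eqP/ffunP => -[].
  rewrite big_ord0 mul1r; congr g; apply/funext => i.
  by rewrite /ffun_point insubF.
rewrite (reindex (@ffun_cons N)); last exact/onW_bij/ffun_cons_bij.
rewrite -(pair_bigA _ (fun a b => (\prod_k (if ffun_cons (a, b) k then p else 1 - p)) *
  g (ffun_point (ffun_cons (a, b))))) /= big_bool /= -!IH !mulr_sumr addrC.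
have prodE a b : \prod_k (if ffun_cons (a, b) k then p else 1 - p) =
    (if a then p else 1 - p) * \prod_(k < N) (if b k then p else 1 - p).
  rewrite big_ord_recl ffunE unlift_none /=; congr (_ * _).
  by apply: eq_bigr => k _; rewrite ffunE liftK.
by congr (_ + _); apply: eq_bigr => b _; rewrite prodE ffun_point_cons mulrA.
Qed.

Variable I : finType.

Definition bpoint (b : {ffun I -> bool}) (u : I) : R := (b u)%:R.

Lemma sum_cubeE (p : R) (G : (I -> R) -> R) :
  \sum_(b : {ffun I -> bool}) (\prod_u (if b u then p else 1 - p)) * G (bpoint b) =
  cubeE p #|I| (fun y => G (fun u => y (enum_rank u))).
Proof.
rewrite -sum_ffun_cubeE.
pose h (b : {ffun 'I_#|I| -> bool}) : {ffun I -> bool} := [ffun u => b (enum_rank u)].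
have hb : bijective h.
  exists (fun b : {ffun I -> bool} => [ffun k : 'I_#|I| => b (enum_val k)]) => b; apply/ffunP => i;
    by rewrite !ffunE ?enum_valK ?enum_rankK.
rewrite (reindex h); last exact/onW_bij.
apply: eq_bigr => b _; congr (_ * _).
  rewrite (reindex (@enum_rank I)) /=; last exact/onW_bij/enum_rank_bij.
  by apply: eq_bigr => u _; rewrite ffunE.
congr G; apply/funext => u; rewrite /bpoint /ffun_point ffunE.
by rewrite (_ : nat_of_ord _ = val (enum_rank u))// valK.
Qed.

(* The last hypothesis says that the infimum convolution of [F] is at least [F - k]. *)
Lemma convex_exp_concentration (p : R) (F : (I -> R) -> R) (k : R) :
  0 <= p <= 1 ->
  (forall l x y, 0 <= l <= 1 ->
     F (fun u => (1 - l) * x u + l * y u) <= (1 - l) * F x + l * F y) ->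
  (forall x, 0 <= F x) ->
  (forall x y, F x - k <= F y + (\sum_u (x u - y u) ^+ 2) / 4) ->
  (\sum_(b : {ffun I -> bool}) (\prod_u (if b u then p else 1 - p)) * expR (F (bpoint b))) *
  (\sum_(b : {ffun I -> bool}) (\prod_u (if b u then p else 1 - p)) * expR (- F (bpoint b)))
  <= expR k.
Proof.
move=> p01 Fconv F0 Flip.
rewrite (sum_cubeE p (fun x => expR (F x))) (sum_cubeE p (fun x => expR (- F x))).
pose f (y : nat -> R) := F (fun u => y (enum_rank u)).
have fconv : cube_convex f by move=> l y z hl _ _; exact: Fconv.
have := cubeE_infconv #|I| p01 fconv (fun y _ => F0 _).
have lb y : f y - k <= infconv #|I| f y.
  apply: lb_le_inf; first by have [] := @infconv_has_inf _ #|I| f y (fun y _ => F0 _).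
  move=> _ [z hz <-]; have := Flip (fun u => y (enum_rank u)) (fun u => z (enum_rank u)).
  rewrite /sqdist (reindex (@enum_rank I)) //=; exact/onW_bij/enum_rank_bij.
have E : cubeE p #|I| (fun y => expR (f y)) <=
    expR k * cubeE p #|I| (fun y => expR (infconv #|I| f y)).
  (* The constant [expR k] is pulled out by [cubeE_lin] with a zero second summand. *)
  have <- : cubeE p #|I| (fun y => expR k * expR (infconv #|I| f y) + 0 * 0) =
      expR k * cubeE p #|I| (fun y => expR (infconv #|I| f y)).
    by rewrite (cubeE_lin _ _ _ _ _ (fun=> 0)) mul0r addr0.
  apply: cubeE_le => // y.
  by rewrite mul0r addr0 -expRD ler_expR -lerBlDl.
set B := cubeE _ _ (fun y => expR (- f y)).
have B0 : 0 < B by apply: cubeE_gt0 => // y; exact: expR_gt0.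
move=> h; apply: le_trans (_ : expR k * (cubeE p #|I| (fun y => expR (infconv #|I| f y)) * B) <= _).
  by rewrite mulrA ler_pM2r.
by rewrite ler_piMr ?expR_ge0.
Qed.

End BooleanCube.

(** * The spectral norm *)

Section SpectralNorm.
Variable R : realType.

(** The nonnegative sum of [(B * a i - C * b i)^2] equals [B * (A * B - C^2)], and one divides by
    [B]; if [B = 0] then every [b i] vanishes. *)
Lemma cauchy_schwarz_sum (I : finType) (a b : I -> R) :
  (\sum_i a i * b i) ^+ 2 <= (\sum_i a i ^+ 2) * (\sum_i b i ^+ 2).
Proof.
set C := \sum_i _ * _; set A := \sum_i a i ^+ 2; set B := \sum_i b i ^+ 2.
have A0 : 0 <= A by apply: sumr_ge0 => i _; exact: sqr_ge0.
have [B0|B0] := ltP 0 B.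
  have : 0 <= \sum_i (B * a i - C * b i) ^+ 2 by apply: sumr_ge0 => i _; exact: sqr_ge0.
  have -> : \sum_i (B * a i - C * b i) ^+ 2 = B ^+ 2 * A - 2 * B * C * C + C ^+ 2 * B.
    transitivity (\sum_i (B ^+ 2 * a i ^+ 2 - 2 * B * C * (a i * b i) + C ^+ 2 * b i ^+ 2)).
      by apply: eq_bigr => i _; ring.
    by rewrite big_split sumrB -!mulr_sumr.
  have -> : B ^+ 2 * A - 2 * B * C * C + C ^+ 2 * B = B * (A * B - C ^+ 2) by ring.
  by rewrite pmulr_rge0// subr_ge0.
have /eqP : B = 0.
  by apply/eqP; rewrite eq_le B0 sumr_ge0// => i _; exact: sqr_ge0.
rewrite psumr_eq0; last by move=> i _; exact: sqr_ge0.
move=> /allP b0.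
have -> : C = 0.
  apply: big1 => i _; have := b0 i (mem_index_enum _).
  by rewrite sqrf_eq0 => /eqP ->; rewrite mulr0.
by rewrite expr0n mulr_ge0// sumr_ge0// => i _; exact: sqr_ge0.
Qed.

Lemma minkowski_sum (I : finType) (a b : I -> R) :
  Num.sqrt (\sum_i (a i + b i) ^+ 2) <=
  Num.sqrt (\sum_i a i ^+ 2) + Num.sqrt (\sum_i b i ^+ 2).
Proof.
have s0 (c : I -> R) : 0 <= \sum_i c i ^+ 2 by apply: sumr_ge0 => i _; exact: sqr_ge0.
have h0 : 0 <= Num.sqrt (\sum_i a i ^+ 2) + Num.sqrt (\sum_i b i ^+ 2).
  by rewrite addr_ge0 ?sqrtr_ge0.
rewrite -[leRHS]ger0_norm// -sqrtr_sqr ler_wsqrtr//.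
rewrite sqrrD !sqr_sqrtr// -sqrtrM//.
have -> : \sum_i (a i + b i) ^+ 2 =
    \sum_i a i ^+ 2 + (\sum_i a i * b i) *+ 2 + \sum_i b i ^+ 2.
  by rewrite -sumrMnl -!big_split /=; apply: eq_bigr => i _; rewrite sqrrD.
rewrite lerD2r lerD2l lerMn2r /=.
apply: le_trans (ler_norm _) _.
by rewrite -sqrtr_sqr ler_wsqrtr// cauchy_schwarz_sum.
Qed.

Variable n : nat.
Implicit Types (A B : 'M[R]_n) (x y : 'cV[R]_n).

Lemma vnorm2_ge0 x : 0 <= vnorm2 x. Proof. exact: sqrtr_ge0. Qed.

Lemma vnorm2D x y : vnorm2 (x + y) <= vnorm2 x + vnorm2 y.
Proof.
rewrite /vnorm2; under eq_bigr => i _ do rewrite mxE.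
exact: minkowski_sum.
Qed.

Lemma vnorm2Z c x : vnorm2 (c *: x) = `|c| * vnorm2 x.
Proof.
rewrite /vnorm2 -sqrtr_sqr -sqrtrM ?sqr_ge0// mulr_sumr; congr Num.sqrt.
by apply: eq_bigr => i _; rewrite mxE exprMn.
Qed.

Lemma vnorm2_0 : vnorm2 (0 : 'cV[R]_n) = 0.
Proof. by rewrite -(scale0r 0) vnorm2Z normr0 mul0r. Qed.

Definition frobenius A : R := Num.sqrt (\sum_i \sum_j A i j ^+ 2).

Lemma vnorm2_mulmx A x : vnorm2 (A *m x) <= frobenius A * vnorm2 x.
Proof.
have s0 (c : 'I_n -> R) : 0 <= \sum_i c i ^+ 2 by apply: sumr_ge0 => i _; exact: sqr_ge0.
rewrite /vnorm2 /frobenius -sqrtrM; last by apply: sumr_ge0 => i _.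
rewrite ler_wsqrtr// mulr_suml; apply: ler_sum => i _.
by rewrite mxE; exact: cauchy_schwarz_sum.
Qed.

Lemma specnorm_has_ub A :
  has_ubound [set vnorm2 (A *m x) | x in [set x | vnorm2 x <= 1]]%classic.
Proof.
exists (frobenius A) => _ [x hx <-]; apply: le_trans (vnorm2_mulmx A x) _.
by rewrite ler_piMr ?sqrtr_ge0.
Qed.

Lemma le_specnorm A x : vnorm2 x <= 1 -> vnorm2 (A *m x) <= specnorm A.
Proof. by move=> hx; apply: ub_le_sup; [exact: specnorm_has_ub|exists x]. Qed.

Lemma specnorm_le A (c : R) :
  (forall x, vnorm2 x <= 1 -> vnorm2 (A *m x) <= c) -> specnorm A <= c.
Proof.
move=> h; apply: ge_sup; last by move=> _ [x hx <-]; exact: h.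
by exists (vnorm2 (A *m 0)), 0 => //=; rewrite vnorm2_0.
Qed.

Lemma specnorm_ge0 A : 0 <= specnorm A.
Proof.
by apply: le_trans (vnorm2_ge0 _) (@le_specnorm A 0 _); rewrite vnorm2_0.
Qed.

Lemma specnorm_frobenius A : specnorm A <= frobenius A.
Proof.
apply: specnorm_le => x hx; apply: le_trans (vnorm2_mulmx A x) _.
by rewrite ler_piMr ?sqrtr_ge0.
Qed.

Lemma specnormD A B : specnorm (A + B) <= specnorm A + specnorm B.
Proof.
apply: specnorm_le => x hx; rewrite mulmxDl; apply: le_trans (vnorm2D _ _) _.
by rewrite lerD ?le_specnorm.
Qed.

Lemma specnormZ_le (c : R) A : 0 <= c -> specnorm (c *: A) <= c * specnorm A.
Proof.
move=> c0; apply: specnorm_le => x hx.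
by rewrite -scalemxAl vnorm2Z ger0_norm// ler_wpM2l// le_specnorm.
Qed.

Lemma specnorm0 : specnorm (0 : 'M[R]_n) = 0.
Proof.
apply/eqP; rewrite eq_le specnorm_ge0 andbT; apply: specnorm_le => x _.
by rewrite mul0mx vnorm2_0.
Qed.

Lemma maxnorm_ge A i j : `|A i j| <= maxnorm A.
Proof.
rewrite /maxnorm (bigD1 i)//= (bigD1 j)//= !le_max lexx //.
Qed.

Lemma maxnorm_ge0 A : 0 <= maxnorm A.
Proof. by rewrite /maxnorm; elim/big_ind: _ => // [x y hx hy|i _]; [rewrite le_max hx|elim/big_ind: _ => // x y hx hy; rewrite le_max hx]. Qed.

(** Real-valued counterpart of [outcome], mirroring [z] across the diagonal. The default 0 is never
    reached, since the pair is sorted first. *)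
Definition symentry (z : UIdx n -> R) (i j : 'I_n) : R :=
  if insub (if (i <= j)%N then (i, j) else (j, i)) is Some u then z u else 0.

Lemma symentry_outcome (b : Omega n) i j :
  symentry (@bpoint R _ b) i j = (outcome b i j)%:R.
Proof. by rewrite /symentry /outcome; case: insub. Qed.

Lemma symentry_lin (a c : R) (y z : UIdx n -> R) i j :
  symentry (fun u => a * y u + c * z u) i j = a * symentry y i j + c * symentry z i j.
Proof. by rewrite /symentry; case: insub => // ; rewrite !mulr0 addr0. Qed.

Lemma symentryC z i j : symentry z i j = symentry z j i.
Proof.
rewrite /symentry; case: (ltngtP i j) => // /val_inj -> //.
Qed.

(** Off-diagonal variables occur in two entries and diagonal ones in one. The part below the
    diagonal is reflected onto the strict upper part, itself bounded by the whole upper part. *)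
Lemma sum_symentry_sq z :
  \sum_i \sum_j symentry z i j ^+ 2 <= 2 * \sum_u z u ^+ 2.
Proof.
pose g (q : 'I_n * 'I_n) := symentry z q.1 q.2 ^+ 2.
have -> : \sum_u z u ^+ 2 = \sum_(q : 'I_n * 'I_n | (q.1 <= q.2)%N) g q.
  rewrite (reindex_omap (val : UIdx n -> _) insub); last first.
    by move=> q hq; rewrite insubT.
  apply: eq_big => [u|u _]; first by rewrite (valP u) valK eqxx.
  by rewrite /g /symentry (valP u) -surjective_pairing valK.
rewrite pair_bigA /= (bigID (fun q : 'I_n * 'I_n => (q.1 <= q.2)%N)) /=.
rewrite mulr_natl mulr2n lerD2l.
rewrite (reindex (fun q : 'I_n * 'I_n => (q.2, q.1))) /=; last first.
  by exists (fun q : 'I_n * 'I_n => (q.2, q.1)) => -[].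
rewrite [leRHS](bigID (fun q : 'I_n * 'I_n => (q.1 < q.2)%N)) /=.
rewrite -[leLHS]addr0 lerD//; last by apply: sumr_ge0 => q _; exact: sqr_ge0.
rewrite le_eqVlt; apply/orP; left; apply/eqP; apply: eq_big => q.
  by rewrite -ltnNge; case: ltngtP.
by rewrite /g symentryC.
Qed.

Variables (p : R) (M : 'M[R]_n).

(* [rp p * Cmat p b i j] is [1 / p - 1] if [outcome b i j] and [-1] otherwise. *)
Definition Eaffine (z : UIdx n -> R) : 'M[R]_n :=
  \matrix_(i, j) (M i j * (symentry z i j / p - 1)).

Lemma Emat_affine (b : Omega n) : 0 < p < 1 -> Emat p M b = Eaffine (@bpoint R _ b).
Proof.
move=> /andP[p0 p1]; apply/matrixP => i j; rewrite !mxE symentry_outcome /rp.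
have q0 : 0 < 1 - p by rewrite subr_gt0.
rewrite mulrCA; congr (_ * _); case: outcome.
  rewrite -expr2 sqr_sqrtr ?divr_ge0 ?ltW// mulr1n; field; lra.
rewrite mulrN -sqrtrM ?divr_ge0 ?ltW//.
have -> : (1 - p) / p * (p / (1 - p)) = 1 by field; lra.
by rewrite sqrtr1 mul0r sub0r.
Qed.

Lemma Eaffine_combine (l : R) (y z : UIdx n -> R) :
  Eaffine (fun u => (1 - l) * y u + l * z u) = (1 - l) *: Eaffine y + l *: Eaffine z.
Proof. by apply/matrixP => i j; rewrite !mxE symentry_lin; ring. Qed.

Lemma specnorm_Eaffine_convex (l : R) (y z : UIdx n -> R) : 0 <= l <= 1 ->
  specnorm (Eaffine (fun u => (1 - l) * y u + l * z u)) <=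
  (1 - l) * specnorm (Eaffine y) + l * specnorm (Eaffine z).
Proof.
move=> /andP[l0 l1]; rewrite Eaffine_combine; apply: le_trans (specnormD _ _) _.
by rewrite lerD// specnormZ_le// subr_ge0.
Qed.

(** The spectral norm of the difference is at most its Frobenius norm. The entries of the difference
    are [M i j / p] times those of the mirrored [y - z], and the mirroring costs the factor 2. *)
Lemma specnorm_Eaffine_lipschitz (y z : UIdx n -> R) : 0 < p ->
  specnorm (Eaffine y) - specnorm (Eaffine z) <=
  Num.sqrt (2 * (maxnorm M / p) ^+ 2 * \sum_u (y u - z u) ^+ 2).
Proof.
move=> p0; rewrite lerBlDl.
have -> : Eaffine y = Eaffine z + (Eaffine y - Eaffine z) by rewrite addrC subrK.
apply: le_trans (specnormD _ _) _; rewrite lerD2l.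
apply: le_trans (specnorm_frobenius _) _; rewrite ler_wsqrtr//.
(* The difference is written [1 * y u + (-1) * z u] to fit [symentry_lin]. *)
apply: le_trans (_ : (maxnorm M / p) ^+ 2 *
    \sum_i \sum_j symentry (fun u => 1 * y u + (-1) * z u) i j ^+ 2 <= _).
  rewrite mulr_sumr; apply: ler_sum => i _; rewrite mulr_sumr; apply: ler_sum => j _.
  rewrite !mxE symentry_lin.
  have -> : M i j * (symentry y i j / p - 1) - M i j * (symentry z i j / p - 1) =
      (M i j / p) * (1 * symentry y i j + -1 * symentry z i j) by ring.
  rewrite exprMn ler_wpM2r ?sqr_ge0// !exprMn ler_wpM2r ?sqr_ge0//.
  by rewrite -real_normK ?num_real// ler_pXn2r ?nnegrE ?maxnorm_ge0 ?maxnorm_ge.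
have -> (s : R) : 2 * (maxnorm M / p) ^+ 2 * s = (maxnorm M / p) ^+ 2 * (2 * s) by ring.
rewrite ler_wpM2l ?sqr_ge0//.
apply: le_trans (sum_symentry_sq _) _.
by rewrite ler_wpM2l// ler_sum// => u _; rewrite mul1r mulN1r.
Qed.

End SpectralNorm.

(** * Deviations from the median *)

Section Concentration.
Variables (R : realType) (n : nat) (p : R).
Hypothesis p01 : 0 < p < 1.
Let p0 : 0 < p. Proof. by case/andP: p01. Qed.
Let p1 : p < 1. Proof. by case/andP: p01. Qed.
Implicit Types (A B : pred (Omega n)) (X Y : Omega n -> R).

Lemma weight_ge0 (b : Omega n) : 0 <= weight p b.
Proof. by apply: prodr_ge0 => k _; case: ifP => _; have := p0; have := p1; lra. Qed.

Lemma sum_weight : \sum_(b : Omega n) weight p b = 1.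
Proof.
rewrite /weight -(bigA_distr_bigA (fun (k : UIdx n) a => if a then p else 1 - p)).
by apply: big1 => k _; rewrite big_bool /= addrC subrK.
Qed.

Lemma Prob_ge0 A : 0 <= Prob p A.
Proof. by apply: sumr_ge0 => b _; exact: weight_ge0. Qed.

Lemma Prob_le A B : (forall b, A b -> B b) -> Prob p A <= Prob p B.
Proof.
move=> AB; rewrite /Prob [leLHS]big_mkcond [leRHS]big_mkcond /=; apply: ler_sum => b _.
by case: ifPn => [/AB ->//|_]; case: ifP => _ //; exact: weight_ge0.
Qed.

Lemma Prob_le1 A : Prob p A <= 1.
Proof. by rewrite -sum_weight; exact: Prob_le. Qed.

Lemma Prob_pred0 A : (forall b, ~~ A b) -> Prob p A = 0.
Proof. by move=> h; apply: big_pred0 => b; exact/negbTE. Qed.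

Lemma Prob_union_le A B C : (forall b, A b -> B b || C b) ->
  Prob p A <= Prob p B + Prob p C.
Proof.
move=> h; apply: le_trans (Prob_le h) _.
rewrite /Prob [leLHS]big_mkcond [X in _ <= X + _]big_mkcond
  [X in _ <= _ + X]big_mkcond /= -big_split /=; apply: ler_sum => b _.
by have := weight_ge0 b; case: (B b); case: (C b) => /= ?; lra.
Qed.

Lemma Expect_le X Y : (forall b, X b <= Y b) -> Expect p X <= Expect p Y.
Proof. by move=> h; apply: ler_sum => b _; rewrite ler_wpM2l ?weight_ge0. Qed.

Lemma ExpectD X Y : Expect p (fun b => X b + Y b) = Expect p X + Expect p Y.
Proof. by rewrite -big_split; apply: eq_bigr => b _; rewrite mulrDr. Qed.

Lemma ExpectZ c X : Expect p (fun b => c * X b) = c * Expect p X.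
Proof. by rewrite mulr_sumr; apply: eq_bigr => b _; rewrite mulrCA. Qed.

Lemma Expect_cst c : Expect p (fun _ : Omega n => c) = c.
Proof. by rewrite /Expect -mulr_suml sum_weight mul1r. Qed.

Lemma exp_markov A X s : (forall b, A b -> s <= X b) ->
  Prob p A * expR s <= Expect p (fun b => expR (X b)).
Proof.
move=> h; rewrite /Prob mulr_suml big_mkcond /=; apply: ler_sum => b _.
case: ifPn => [/h|_]; last by rewrite mulr_ge0 ?weight_ge0 ?expR_ge0.
by rewrite -ler_expR => hb; rewrite ler_wpM2l ?weight_ge0.
Qed.

Variable M : 'M[R]_n.
Let X b := specnorm (Emat p M b).
Let K := maxnorm M / p.

(** At distance [r], the function [c * X] drops by at most [sqrt 2 * c * K * r]. The maximum over
    [r] of this minus [r^2 / 4] is [2 * c^2 * K^2], the constant [k] of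
    [convex_exp_concentration]. *)
Lemma specnorm_exp_concentration c : 0 <= c ->
  Expect p (fun b => expR (c * X b)) * Expect p (fun b => expR (- (c * X b)))
  <= expR (2 * c ^+ 2 * K ^+ 2).
Proof.
move=> c0.
have p01' : 0 <= p <= 1 by rewrite !ltW.
have Xaff b : X b = specnorm (Eaffine p M (@bpoint R _ b)) by rewrite /X Emat_affine.
rewrite /Expect; under eq_bigr do rewrite Xaff.
under [X in _ * X <= _]eq_bigr do rewrite Xaff.
apply: (@convex_exp_concentration R _ p (fun z => c * specnorm (Eaffine p M z))) => //.
- move=> l x y hl; rewrite mulrCA [l * (c * _)]mulrCA -mulrDr ler_wpM2l//.
  exact: specnorm_Eaffine_convex.
- by move=> z; rewrite mulr_ge0// specnorm_ge0.
move=> x y; rewrite lerBlDr -addrA -lerBlDl -mulrBr.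
apply: le_trans (ler_wpM2l c0 (specnorm_Eaffine_lipschitz M x y p0)) _.
rewrite -/K; set S := \sum_u _.
have S0 : 0 <= S by apply: sumr_ge0 => u _; exact: sqr_ge0.
have K0 := sqr_ge0 K; have cc0 := sqr_ge0 c.
have r0 : 0 <= S / 4 + 2 * c ^+ 2 * K ^+ 2 by have := mulr_ge0 cc0 K0; lra.
(* AM-GM: [c * sqrt (2 * K^2 * S) <= S / 4 + 2 * c^2 * K^2] *)
rewrite -(@ler_pXn2r _ 2) ?nnegrE ?mulr_ge0 ?sqrtr_ge0//.
have KS : 0 <= 2 * K ^+ 2 * S by have := mulr_ge0 K0 S0; lra.
rewrite exprMn (sqr_sqrtr KS) -subr_ge0.
have -> : (S / 4 + 2 * c ^+ 2 * K ^+ 2) ^+ 2 - c ^+ 2 * (2 * K ^+ 2 * S) =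
  (S / 4 - 2 * c ^+ 2 * K ^+ 2) ^+ 2 by field.
exact: sqr_ge0.
Qed.

(** The level [a] cancels in the product of the two Markov bounds, which leaves the exponent
    [2 * c^2 * K^2 - c * t]. *)
Lemma separated_Prob A B a t : 0 < K -> 0 < t ->
  (forall b, A b -> a + t <= X b) -> (forall b, B b -> X b <= a) ->
  Prob p A * Prob p B <= expR (- (t ^+ 2 / (8 * K ^+ 2))).
Proof.
move=> K0 t0 hA hB.
(* [c] minimises [2 * c^2 * K^2 - c * t] *)
pose c := t / (4 * K ^+ 2).
have c0 : 0 < c by apply: divr_gt0 => //; apply: mulr_gt0 => //; exact: exprn_gt0.
have hA' : Prob p A * expR (c * (a + t)) <= Expect p (fun b => expR (c * X b)).
  by apply: exp_markov => b Ab; rewrite ler_pM2l// hA.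
have hB' : Prob p B * expR (- (c * a)) <= Expect p (fun b => expR (- (c * X b))).
  by apply: exp_markov => b Bb; rewrite lerN2 ler_pM2l// hB.
have h := specnorm_exp_concentration (ltW c0).
have := ler_pM (mulr_ge0 (Prob_ge0 A) (expR_ge0 _)) (mulr_ge0 (Prob_ge0 B) (expR_ge0 _)) hA' hB'.
move=> /le_trans /(_ h).
rewrite mulrACA -expRD.
have -> : c * (a + t) + - (c * a) = c * t by ring.
rewrite -ler_pdivlMr ?expR_gt0// -expRN -expRD.
suff -> : 2 * c ^+ 2 * K ^+ 2 - c * t = - (t ^+ 2 / (8 * K ^+ 2)) by [].
by rewrite /c; field; rewrite gt_eqF.
Qed.

(** Each one-sided deviation is separated by [t] from a half-line event of probability at least 1/2,
    so its own probability is at most [2 * e]; the two sides add up to [4 * e]. *)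
Lemma median_tail m t : 0 < K -> is_median p X m -> 0 < t ->
  Prob p (fun b => t < `|X b - m|) <= 4 * expR (- (t ^+ 2 / (8 * K ^+ 2))).
Proof.
move=> K0 [m1 m2] t0; set e := expR _.
have h1 := @separated_Prob (fun b => m + t <= X b) (fun b => X b <= m) m t K0 t0
  (fun _ h => h) (fun _ h => h).
have h2 := @separated_Prob (fun b => m <= X b) (fun b => X b <= m - t) (m - t) t K0 t0.
have {}h2 : Prob p (fun b => m <= X b) * Prob p (fun b => X b <= m - t) <= e.
  by apply: h2 => // b; rewrite subrK.
apply: le_trans (@Prob_union_le _ (fun b => m + t <= X b) (fun b => X b <= m - t) _) _.
  by move=> b; rewrite ltr_normr => /orP[] h; apply/orP; [left|right]; lra.
have P1 := Prob_ge0 (fun b => m + t <= X b).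
have P2 := Prob_ge0 (fun b => X b <= m - t).
rewrite -/e in h1; nra.
Qed.

Lemma median_ge0 m : is_median p X m -> 0 <= m.
Proof.
move=> [m1 _]; rewrite leNgt; apply/negP => m0.
suff e : Prob p (fun b => X b <= m) = 0 by move: m1; rewrite e; lra.
by apply: Prob_pred0 => b; rewrite -ltNge; apply: lt_le_trans m0 (specnorm_ge0 _).
Qed.

Lemma specnorm_eq0 b : maxnorm M = 0 -> X b = 0.
Proof.
move=> M0; rewrite /X (_ : Emat p M b = 0) ?specnorm0//.
apply/matrixP => i j; rewrite !mxE.
have := maxnorm_ge M i j; rewrite M0 normr_le0 => /eqP ->.
by rewrite mul0r mulr0.
Qed.

End Concentration.

(** * Moments of variables with Gaussian tails *)

Section GaussianMoments.
Variable R : realType.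
Let mu := @lebesgue_measure R.
Implicit Types (f F : R -> R).

Lemma measurable_EFin_continuous (D : set R) f : measurable D -> continuous f ->
  measurable_fun D (EFin \o f).
Proof.
move=> mD cf; apply/measurable_EFinP; apply: measurable_funTS.
exact: continuous_measurable_fun.
Qed.

Lemma integral_derivative F f (s : R) : 0 <= s -> continuous f ->
  (forall x : R, is_derive x 1 F (f x)) ->
  (\int[mu]_(x in `[0%R, s]) (f x)%:E = (F s - F 0)%:E)%E.
Proof.
rewrite le_eqVlt => /orP[/eqP <-|s0] cf dF.
  by rewrite set_itv1 integral_set1 subrr.
have cF : continuous F.
  move=> x; apply/differentiable_continuous/derivable1_diffP.
  exact: (@ex_derive _ _ _ _ _ _ _ (dF x)).
rewrite (@continuous_FTC2 R f F 0 s) ?EFinB//.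
- exact: continuous_subspaceT.
- split.
  + move=> x _; exact: (@ex_derive _ _ _ _ _ _ _ (dF x)).
  + by apply: cvg_at_right_filter; exact: cF.
  + by apply: cvg_at_left_filter; exact: cF.
- by move=> x _; rewrite derive1E (@derive_val _ _ _ _ _ _ _ (dF x)).
Qed.

(** [F (Y b)] is the integral of [f] over [t < Y b]; exchanging the finite sum with the integral
    turns the weights into the tail sum. The common bound [s] keeps the integrals on a compact
    interval. *)
Lemma layer_cake (T : finType) (w Y : T -> R) (q F f : R -> R) (s : R) :
  (forall b, 0 <= w b) -> (forall b, 0 <= Y b <= s) ->
  continuous q -> continuous f -> (forall x : R, is_derive x 1 F (f x)) ->
  (forall x, 0 <= x -> 0 <= f x) -> F 0 = 0 ->
  (forall t, 0 <= t -> \sum_(b | t < Y b) w b <= q t) ->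
  ((\sum_b w b * F (Y b))%:E <= \int[mu]_(t in `[0%R, s]) (f t * q t)%:E)%E.
Proof.
move=> w0 Y0s cq cf dF f0 F0 tail.
have mf (D : set R) : measurable D -> measurable_fun D (EFin \o f).
  by move=> mD; exact: measurable_EFin_continuous.
(* The interval is open at [Y b] to match the strict inequality in the tail; the endpoint is
   restored before the fundamental theorem is applied. *)
pose h b (t : R) : \bar R := ((w b)%:E * ((EFin \o f) \_ `[0%R, Y b[%classic) t)%E.
have hm b : measurable_fun `[0%R, s]%classic (h b).
  apply: measurable_funeM; apply/measurable_restrict => //.
  by apply: mf; exact: measurableI.
have hnn b t : `[0%R, s]%classic t -> (0 <= h b t)%E.
  rewrite /= in_itv /= => /andP[t0 _]; rewrite mule_ge0 ?lee_fin//.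
  by rewrite /patch; case: ifP => // _; rewrite lee_fin f0.
have -> : (\sum_b w b * F (Y b))%:E = (\sum_b \int[mu]_(t in `[0%R, s]) h b t)%E.
  rewrite -sumEFin; apply: eq_bigr => b _.
  have /andP[Yb0 Ybs] := Y0s b.
  rewrite /h ge0_integralZl//; first last.
  - by rewrite lee_fin.
  - move=> t; rewrite /= in_itv /= => /andP[t0 _].
    by rewrite /patch; case: ifP => // _; rewrite lee_fin f0.
  - apply/measurable_restrict => //; by apply: mf; exact: measurableI.
  rewrite -integral_mkcondr (_ : _ `&` _ = `[0%R, Y b[%classic)%classic; last first.
    apply/seteqP; split => t /=; rewrite !in_itv /=; first by case.
    by move=> /andP[t0 tY]; rewrite t0 tY (le_trans (ltW tY)).
  rewrite integral_itv_bndo_bndc; last exact: mf.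
  by rewrite (integral_derivative Yb0 cf dF) F0 subr0 EFinM.
rewrite -(@ge0_integral_sum _ _ R mu _ _ _ _ hm hnn)//.
have cfq : continuous (fun t => f t * q t).
  by move=> x; apply: continuousM; [exact: cf|exact: cq].
apply: ge0_le_integral => //.
- by move=> t ht; apply: sume_ge0 => b _; exact: hnn.
- exact: emeasurable_sum.
- exact: (measurable_EFin_continuous _ cfq).
move=> t; rewrite /= in_itv /= => /andP[t0 _].
rewrite (_ : (\sum_b h b t)%E = (f t * \sum_(b | t < Y b) w b)%:E).
  by rewrite lee_fin ler_wpM2l ?f0 ?tail.
rewrite [X in (_ * X)%:E]big_mkcond mulr_sumr -sumEFin; apply: eq_bigr => b _.
rewrite /h /patch mem_setE in_itv /= t0 /=.
case: ifP => _; first by rewrite -EFinM mulrC.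
by rewrite mule0 mulr0.
Qed.


Lemma integral_gauss_le (s : R) :
  (\int[mu]_(x in `[0%R, s]) (gauss_fun x)%:E <= (Num.sqrt pi / 2)%:E)%E.
Proof.
rewrite -integral0y_gauss; apply: ge0_subset_integral => //.
- by apply: measurable_EFin_continuous => //; exact: continuous_gauss_fun.
- by move=> x _; rewrite lee_fin gauss_fun_ge0.
- by move=> x /=; rewrite !in_itv /= => /andP[-> _].
Qed.

Lemma is_derive_gauss (x : R) : is_derive x 1 (@gauss_fun R) (- (2 * x) * gauss_fun x).
Proof. by rewrite /gauss_fun; apply: is_derive_eq; rewrite /GRing.scale /=; ring. Qed.

Let cgauss : continuous (@gauss_fun R) := @continuous_gauss_fun R.

(** * Moments under the tail 4 exp(-t^2) *)

Section Tail.
Variables (T : finType) (w Y : T -> R).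
Hypotheses (w0 : forall b, 0 <= w b) (Y0 : forall b, 0 <= Y b).

Section StandardTail.
Hypothesis tail : forall t, 0 <= t -> \sum_(b | t < Y b) w b <= 4 * gauss_fun t.

(** A convenient common upper bound for the nonnegative [Y b]; the moment bounds do not depend on
    it. *)
Let s := \sum_b Y b.

Let Y0s b : 0 <= Y b <= s.
Proof. by rewrite Y0 /s (bigD1 b)//= lerDl sumr_ge0. Qed.

Let s0 : 0 <= s. Proof. exact: sumr_ge0. Qed.

Let cq : continuous (fun t : R => 4 * gauss_fun t).
Proof. by move=> x; apply: cvgM; [exact: cvg_cst|exact: cgauss]. Qed.

Let integral_gauss4 (c : R) : 0 <= c ->
  (\int[mu]_(t in `[0%R, s]) (c * gauss_fun t)%:E <= (c / 2 * Num.sqrt pi)%:E)%E.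
Proof.
move=> c0; under eq_integral do rewrite EFinM.
rewrite ge0_integralZl//; last first.
- by move=> x _; rewrite lee_fin gauss_fun_ge0.
- exact: (measurable_EFin_continuous _ cgauss).
apply: le_trans (lee_wpmul2l _ (integral_gauss_le s)) _; first by rewrite lee_fin.
by rewrite -EFinM lee_fin mulrCA mulrC.
Qed.

Lemma gauss_moment1 : \sum_b w b * Y b <= 2 * Num.sqrt pi.
Proof.
rewrite -lee_fin; apply: le_trans
  (@layer_cake T w Y _ (fun x => x) (fun=> 1) s w0 Y0s cq _ _ _ _ tail) _ => //.
- by move=> x; exact: cst_continuous.
- under eq_integral do rewrite mul1r.
  have := @integral_gauss4 4; rewrite (_ : 4 / 2 = 2); first exact.
  by field.
Qed.

(** The integrand [8 t exp (- t^2)] has antiderivative [- 4 exp (- t^2)], whose increment from 0 is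
    at most 4. *)
Lemma gauss_moment2 : \sum_b w b * Y b ^+ 2 <= 4.
Proof.
have c2 : continuous (fun x : R => 2 * x).
  by move=> x; apply: cvgM; [exact: cvg_cst|exact: cvg_id].
rewrite -lee_fin; apply: le_trans
  (@layer_cake T w Y _ (fun x => x ^+ 2) (fun x => 2 * x) s w0 Y0s cq c2 _ _ _ tail) _ => //.
- by move=> x; apply: is_derive_eq; rewrite /GRing.scale /=; ring.
- by move=> x x0; rewrite mulr_ge0.
- by rewrite expr0n.
have c8 : continuous (fun x : R => 2 * x * (4 * gauss_fun x)).
  by move=> x; apply: continuousM; [exact: c2|exact: cq].
have d8 (x : R) : is_derive x 1 (fun x => - 4 * gauss_fun x) (2 * x * (4 * gauss_fun x)).
  have hx := is_derive_gauss x.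
  by apply: is_derive_eq; rewrite /GRing.scale /=; ring.
rewrite (integral_derivative s0 c8 d8) lee_fin {2}/gauss_fun expr0n oppr0 expR0.
by have := gauss_fun_ge0 s; lra.
Qed.

(* 12 t^2 exp (- t^2) is the derivative of - 6 t exp (- t^2), plus 6 exp (- t^2) *)
Lemma gauss_moment3 : \sum_b w b * Y b ^+ 3 <= 3 * Num.sqrt pi.
Proof.
have c2 : continuous (fun x : R => 3 * x ^+ 2).
  by move=> x; apply: cvgM; [exact: cvg_cst|exact: exprn_continuous].
rewrite -lee_fin; apply: le_trans
  (@layer_cake T w Y _ (fun x => x ^+ 3) (fun x => 3 * x ^+ 2) s w0 Y0s cq c2 _ _ _ tail) _ => //.
- by move=> x; apply: is_derive_eq; rewrite /GRing.scale /=; ring.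
- by move=> x x0; rewrite mulr_ge0 ?sqr_ge0.
- by rewrite expr0n.
pose f1 (t : R) := 3 * t ^+ 2 * (4 * gauss_fun t) - 6 * gauss_fun t.
have cg6 : continuous (fun t : R => 6 * gauss_fun t).
  by move=> x; apply: cvgM; [exact: cvg_cst|exact: cgauss].
have cf1 : continuous f1.
  move=> x; apply: cvgB; last exact: cg6.
  by apply: cvgM; [exact: c2|exact: cq].
have intc (g : R -> R) : continuous g -> mu.-integrable `[0%R, s]%classic (EFin \o g).
  move=> cg; apply: continuous_compact_integrable; first exact: segment_compact.
  exact: continuous_subspaceT.
under eq_integral => t _.
  rewrite (_ : 3 * t ^+ 2 * (4 * gauss_fun t) = f1 t + 6 * gauss_fun t); last first.
    by rewrite /f1 subrK.
  rewrite EFinD; over.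
rewrite (integralD _ (intc _ cf1) (intc _ cg6))//=.
have d1 (x : R) : is_derive x 1 (fun x => - 6 * x * gauss_fun x) (f1 x).
  have hx := is_derive_gauss x.
  by apply: is_derive_eq; rewrite /GRing.scale /f1 /=; ring.
rewrite (integral_derivative s0 cf1 d1).
apply: le_trans (leeD2l _ (@integral_gauss4 6 _)) _ => //.
rewrite -EFinD lee_fin mulr0 mul0r subr0.
have := mulr_ge0 s0 (gauss_fun_ge0 s); rewrite (_ : 6 / 2 = 3); last by field.
lra.
Qed.

End StandardTail.
End Tail.

(** * Rescaling by sqrt a to the tail 4 exp(-t^2/a) *)

Section ScaledTail.
Variables (T : finType) (w Y : T -> R) (a : R).
Hypotheses (w0 : forall b, 0 <= w b) (Y0 : forall b, 0 <= Y b) (a0 : 0 < a).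
Hypothesis tail : forall t, 0 <= t -> \sum_(b | t < Y b) w b <= 4 * expR (- (t ^+ 2 / a)).

Let sg := Num.sqrt a.
Let sg0 : 0 < sg. Proof. by rewrite sqrtr_gt0. Qed.
Let Z b := Y b / sg.
Let Z0 b : 0 <= Z b. Proof. by rewrite divr_ge0// ltW. Qed.
Let YE b : Y b = sg * Z b. Proof. by rewrite mulrC divfK// gt_eqF. Qed.

Let Ztail t : 0 <= t -> \sum_(b | t < Z b) w b <= 4 * gauss_fun t.
Proof.
move=> t0; have := tail (mulr_ge0 t0 (ltW sg0)).
rewrite exprMn (sqr_sqrtr (ltW a0)) mulfK ?gt_eqF// => h.
rewrite (eq_bigl (fun b => t * sg < Y b))// => b.
by rewrite /Z ltr_pdivlMr.
Qed.

Lemma subgaussian_moment1 : \sum_b w b * Y b <= 2 * Num.sqrt pi * sg.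
Proof.
under eq_bigr do rewrite YE mulrCA; rewrite -mulr_sumr mulrC ler_pM2r//.
exact: gauss_moment1.
Qed.

Lemma subgaussian_moment2 : \sum_b w b * Y b ^+ 2 <= 4 * a.
Proof.
under eq_bigr do rewrite YE exprMn mulrCA.
by rewrite -mulr_sumr (sqr_sqrtr (ltW a0)) mulrC ler_pM2r// gauss_moment2.
Qed.

Lemma subgaussian_moment3 : \sum_b w b * Y b ^+ 3 <= 3 * Num.sqrt pi * sg ^+ 3.
Proof.
under eq_bigr do rewrite YE exprMn mulrCA; rewrite -mulr_sumr mulrC ler_pM2r ?exprn_gt0//.
exact: gauss_moment3.
Qed.

End ScaledTail.

End GaussianMoments.

(** * Tail and moment bounds for the random matrix E *)

Theorem mainTheorem6 (R : realType) (n : nat) (p : R) (M : 'M[R]_n) (mE : R) :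
  0 < p < 1 ->
  is_median p (fun b => specnorm (Emat p M b)) mE ->
  [/\ (forall t : R, 0 < t ->
         Prob p (fun b => `|specnorm (Emat p M b) - mE| > t)
         <= 4 * expR (- (p ^+ 2 / (8 * maxnorm M ^+ 2)) * t ^+ 2)),
      Expect p (fun b => specnorm (Emat p M b) ^+ 2)
        <= mE ^+ 2 + 32 * (maxnorm M ^+ 2 / p ^+ 2)
           + 8 * mE * Num.sqrt (2 * pi * maxnorm M ^+ 2 / p ^+ 2)
    & Expect p (fun b => specnorm (Emat p M b) ^+ 3)
        <= 4 * mE ^+ 3
           + 12 * Num.sqrt pi * powR (8 * maxnorm M ^+ 2 / p ^+ 2) (3 / 2)].
Proof.
move=> p01 hmed; have /andP[p0 p1] := p01.
have m0 := median_ge0 hmed.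
(* If [M = 0] the Gaussian scale degenerates, but the norm is identically 0, which forces the median
   to be 0. *)
have [K0|M0] := ltP 0 (maxnorm M); last first.
  have {}M0 : maxnorm M = 0 by apply/eqP; rewrite eq_le M0 maxnorm_ge0.
  have X0 b : specnorm (Emat p M b) = 0 by exact: specnorm_eq0.
  have mE0 : mE = 0.
    apply/eqP; rewrite eq_le m0 andbT leNgt; apply/negP => mpos.
    have [_] := hmed; rewrite Prob_pred0; first lra.
    by move=> b; rewrite X0 -ltNge.
  split=> [t t0||].
  - rewrite Prob_pred0 ?mulr_ge0 ?expR_ge0// => b.
    by rewrite X0 mE0 subrr normr0 -leNgt ltW.
  - rewrite /Expect big1 => [|b _]; last by rewrite X0 expr0n mulr0.
    by rewrite mE0 M0 !expr0n /= !(mul0r, mulr0) !addr0.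
  - rewrite /Expect big1 => [|b _]; last by rewrite X0 expr0n mulr0.
    by rewrite mE0 !expr0n /= mulr0 add0r mulr_ge0 ?powR_ge0// mulr_ge0 ?sqrtr_ge0.
set K := maxnorm M / p; have Kp : 0 < K by rewrite divr_gt0.
have tailt t : 0 < t -> Prob p (fun b => t < `|specnorm (Emat p M b) - mE|) <=
    4 * expR (- (t ^+ 2 / (8 * K ^+ 2))) by exact: median_tail.
pose Y (b : Omega n) := `|specnorm (Emat p M b) - mE|.
have a0 : 0 < 8 * K ^+ 2 by rewrite mulr_gt0 ?exprn_gt0.
have tail t : 0 <= t -> \sum_(b | t < Y b) weight p b <= 4 * expR (- (t ^+ 2 / (8 * K ^+ 2))).
  rewrite le_eqVlt => /orP[/eqP <-|]; last exact: tailt.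
  (* At [t = 0] the bound is 4, and a probability is at most 1. *)
  rewrite expr0n mul0r oppr0 expR0.
  by have := Prob_le1 p01 (fun b => 0 < Y b); rewrite /Prob; lra.
have Y0 b : 0 <= Y b by exact: normr_ge0.
have w0 := @weight_ge0 R n p p01.
have := subgaussian_moment1 w0 Y0 a0 tail.
have := subgaussian_moment2 w0 Y0 a0 tail.
have := subgaussian_moment3 w0 Y0 a0 tail.
rewrite -![\sum_b _]/(Expect p _).
set s := Num.sqrt (8 * K ^+ 2) => h3 h2 h1.
have XY b : specnorm (Emat p M b) <= mE + Y b.
  by have := ler_norm (specnorm (Emat p M b) - mE); rewrite -/(Y b); lra.
split=> [t t0||].
- apply: le_trans (tailt t t0) _; rewrite le_eqVlt; apply/orP; left; apply/eqP.
  congr (_ * expR _); rewrite /K; field.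
  by rewrite !gt_eqF.
- apply: le_trans (@Expect_le _ _ _ p01 _
    (fun b => (mE ^+ 2 + 2 * mE * Y b) + Y b ^+ 2) _) _.
    move=> b; apply: le_trans (_ : (mE + Y b) ^+ 2 <= _).
      by rewrite ler_pXn2r ?nnegrE ?specnorm_ge0 ?addr_ge0.
    by rewrite le_eqVlt; apply/orP; left; apply/eqP; ring.
  rewrite !ExpectD ExpectZ Expect_cst.
  (* Since [s^2 = 8 K^2], the cross term [2 mE * (2 sqrt pi * s)] becomes 8 mE times this root, and
     [4 * 8 K^2] gives the constant 32. *)
  have -> : Num.sqrt (2 * pi * maxnorm M ^+ 2 / p ^+ 2) = Num.sqrt pi * s / 2.
    rewrite /s -sqrtrM ?pi_ge0//.
    have -> : pi * (8 * K ^+ 2) = 2 ^+ 2 * (2 * pi * maxnorm M ^+ 2 / p ^+ 2).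
      by rewrite /K; field; rewrite gt_eqF.
    rewrite [in RHS]sqrtrM ?sqr_ge0// sqrtr_sqr ger0_norm//; by field.
  have -> : maxnorm M ^+ 2 / p ^+ 2 = K ^+ 2 by rewrite /K expr_div_n.
  have : mE * Expect p Y <= mE * (2 * Num.sqrt pi * s) by rewrite ler_wpM2l.
  lra.
apply: le_trans (@Expect_le _ _ _ p01 _ (fun b => 4 * mE ^+ 3 + 4 * Y b ^+ 3) _) _.
  move=> b; apply: le_trans (_ : (mE + Y b) ^+ 3 <= _).
    by rewrite ler_pXn2r ?nnegrE ?specnorm_ge0 ?addr_ge0.
  rewrite -subr_ge0.
  have -> : 4 * mE ^+ 3 + 4 * Y b ^+ 3 - (mE + Y b) ^+ 3 =
    3 * ((mE + Y b) * (mE - Y b) ^+ 2) by ring.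
  by rewrite mulr_ge0// mulr_ge0 ?sqr_ge0 ?addr_ge0.
rewrite ExpectD Expect_cst ExpectZ.
(* Four times the third-moment bound [3 sqrt pi * s^3] gives the coefficient 12. *)
have -> : powR (8 * maxnorm M ^+ 2 / p ^+ 2) (3 / 2) = s ^+ 3.
  have -> : 8 * maxnorm M ^+ 2 / p ^+ 2 = 8 * K ^+ 2 by rewrite /K; field; rewrite gt_eqF.
  rewrite [3 / 2]mulrC powRrM powR12_sqrt; last exact: ltW.
  by rewrite (powR_mulrn 3) ?sqrtr_ge0.
lra.
Qed.
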